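(* Let $X$ be a Banach space and let $G\subseteq\mathcal{L}(X)$ be a compact topological group of isometries acting on $X$. Suppose that $f\colon X\to\mathbb{R}\cup\{+\infty\}$ is a proper, convex, lower semicontinuous and $G$-invariant function. Then for all $\epsilon,\lambda>0$, any $G$-invariant point $x_0\in\mathrm{Dom}(f)$ and any $G$-invariant functional $x_0^*\in\partial_\epsilon f(x_0)$, there exist a $G$-invariant point $z\in\mathrm{Dom}(f)$ and a functional $x^*\in X^*_G$ such that \[ x^*\in\partial f(z),\qquad \Vert z-x_0\Vert\le\frac{\epsilon}{\lambda},\qquad \Vert x^*-x_0^*\Vert\le\lambda . \]
   Context: $\mathcal{L}(X)$ is the space of continuous linear maps $X\to X$ with the operator norm topology; $G\subseteq \mathcal{L}(X)$ is a group (under composition) of invertible bounded linear maps with the relative topology. Functionals are real-valued. A point $x\in X$ is $G$-invariant if $g(x)=x$ for all $g\in G$; a function or functional $f$ on $X$ is $G$-invariant if $f(g(x))=f(x)$ for all $x\in X$, $g\in G$. $X^*_G$ is the set of $G$-invariant elements of $X^*$. $\mathrm{Dom}(f)=\{x\in X\mid f(x)<+\infty\}$, and $f$ is proper if it is not identically $+\infty$ (and never $-\infty$). For $x_0\in\mathrm{Dom}(f)$ and $\epsilon>0$, \[ \partial_\epsilon f(x_0)=\{h\in X^*\mid \langle h,x-x_0\rangle\le f(x)-f(x_0)+\epsilon\ \ \forall x\in X\}, \] \[ \partial f(x_0)=\{h\in X^*\mid \langle h,x-x_0\rangle\le f(x)-f(x_0)\ \ \forall x\in X\}. \] *)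

(* Defs.v *)
From HB Require Import structures.
From mathcomp Require Import all_boot all_order all_algebra.
From mathcomp Require Import all_classical all_reals all_analysis.

Set Implicit Arguments.
Unset Strict Implicit.
Unset Printing Implicit Defensive.

Import Order.TTheory GRing.Theory Num.Theory.
Import numFieldNormedType.Exports.

Local Open Scope classical_set_scope.
Local Open Scope ring_scope.

(* [clmap V W] is the space of continuous linear maps, carved out of the
   L-module of all functions [V -> W]. Its topology is the one induced by the
   operator norm, not the one inherited from a function space. *)
Section clmap.
Context {R : realType} (V W : normedModType R).

Definition clmap_pred : {pred V -> W} :=
  [pred f : V -> W | `[< linear f /\ continuous f >]].

Record clmap := Clmap {
  clmap_fun :> V -> W ;
  clmapP : clmap_fun \in clmap_pred }.

HB.instance Definition _ := [isSub for clmap_fun].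
HB.instance Definition _ := [Choice of clmap by <:].

Lemma clmap_submod_closed : submod_closed clmap_pred.
Proof.
split=> [|a f g].
  apply/asboolP; split; first by move=> a x y; rewrite /= scaler0 addr0.
  by move=> x; exact: cvg_cst.
move=> /asboolP[lf cf] /asboolP[lg cg]; apply/asboolP; split.
  move=> k x y.
  rewrite [LHS](_ : _ = a *: f (k *: x + y) + g (k *: x + y))//.
  rewrite [RHS](_ : _ = k *: (a *: f x + g x) + (a *: f y + g y))//.
  by rewrite lf lg !scalerDr !scalerA (mulrC k) addrACA.
by move=> x; apply: cvgD; [apply: cvgZr; exact: cf|exact: cg].
Qed.

HB.instance Definition _ :=
  GRing.isSubmodClosed.Build _ _ clmap_pred clmap_submod_closed.
HB.instance Definition _ := [SubChoice_isSubLmodule of clmap by <:].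

Lemma clmap_linear (f : clmap) : linear f.
Proof. by case: f => f /= /asboolP[]. Qed.

HB.instance Definition _ (f : clmap) :=
  GRing.isLinear.Build R V W _ (clmap_fun f) (@clmap_linear f).

Lemma clmap_continuous (f : clmap) : continuous f.
Proof. by case: f => f /= /asboolP[]. Qed.

Lemma clmapD (f g : clmap) x : (f + g) x = f x + g x. Proof. by []. Qed.
Lemma clmapZ (a : R) (f : clmap) x : (a *: f) x = a *: f x. Proof. by []. Qed.

Definition opnorm (f : clmap) : R :=
  sup [set `|f x| | x in [set x : V | `|x| <= 1]].

Lemma opnorm_has_sup (f : clmap) :
  has_sup [set `|f x| | x in [set x : V | `|x| <= 1]].
Proof.
split; first by exists `|f 0|; exists 0 => //=; rewrite normr0.
have /linear_bounded_continuous/bounded_funP/(_ 1)[M fM] :=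
  @clmap_continuous f.
by exists M => _ [x /= x1 <-]; exact: fM.
Qed.

Lemma le_opnorm (f : clmap) x : `|f x| <= opnorm f * `|x|.
Proof.
have [->|x0] := eqVneq x 0; first by rewrite linear0 !normr0 mulr0.
have nx0 : 0 < `|x| by rewrite normr_gt0.
rewrite -ler_pdivrMr//.
have -> : `|f x| / `|x| = `|f (`|x|^-1 *: x)|.
  by rewrite linearZ/= normrZ normfV normr_id mulrC.
apply: ub_le_sup; first by case: (opnorm_has_sup f).
by exists (`|x|^-1 *: x) => //=; rewrite normfZV.
Qed.

Lemma opnorm_le (f : clmap) (M : R) :
  (forall x, `|x| <= 1 -> `|f x| <= M) -> opnorm f <= M.
Proof.
move=> fM; apply: ge_sup; first by case: (opnorm_has_sup f).
by move=> _ [x /= x1 <-]; exact: fM.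
Qed.

Lemma opnorm_ge0 (f : clmap) : 0 <= opnorm f.
Proof.
apply: (@le_trans _ _ `|f 0|) => //; apply: ub_le_sup.
  by case: (opnorm_has_sup f).
by exists 0 => //=; rewrite normr0.
Qed.

Let opnormD (f g : clmap) : opnorm (f + g) <= opnorm f + opnorm g.
Proof.
apply: opnorm_le => x x1; rewrite clmapD (le_trans (ler_normD _ _))//.
by rewrite lerD// (le_trans (le_opnorm _ _))// ler_piMr// opnorm_ge0.
Qed.

Let opnormZ_le (a : R) (f : clmap) : opnorm (a *: f) <= `|a| * opnorm f.
Proof.
apply: opnorm_le => x x1; rewrite clmapZ normrZ ler_wpM2l//.
by rewrite (le_trans (le_opnorm _ _))// ler_piMr// opnorm_ge0.
Qed.

Let opnormZ (a : R) (f : clmap) : opnorm (a *: f) = `|a| * opnorm f.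
Proof.
apply/eqP; rewrite eq_le opnormZ_le/=.
have [->|a0] := eqVneq a 0; first by rewrite normr0 mul0r opnorm_ge0.
rewrite -ler_pdivlMl ?normr_gt0// -normfV.
by rewrite -[in leLHS](scalerK a0 f) opnormZ_le.
Qed.

Let opnorm0_eq0 (f : clmap) : opnorm f = 0 -> f = 0.
Proof.
move=> f0; apply/val_inj/funext => x /=; apply/eqP.
by rewrite -normr_le0 (le_trans (le_opnorm _ _))// f0 mul0r.
Qed.

HB.instance Definition _ :=
  Lmodule_isNormed.Build R clmap opnormD opnormZ opnorm0_eq0.

Lemma clmap_normE (f : clmap) : `|f| = opnorm f. Proof. by []. Qed.

End clmap.

Arguments clmap_pred {R} V W.

Notation "''L' ( V , W )" := (clmap V W)
  (at level 8, format "''L' ( V ,  W )") : type_scope.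
Notation "''L' ( V )" := (clmap V V)
  (at level 8, format "''L' ( V )") : type_scope.

Definition dual {R : realType} (X : normedModType R) := 'L(X, R^o).

Section group_of_maps.
Context {R : realType} {X : normedModType R}.

Lemma clid_subproof : (idfun : X -> X) \in clmap_pred X X.
Proof. by apply/asboolP; split=> // x; exact: cvg_id. Qed.

Definition clid : 'L(X) := Clmap clid_subproof.

Lemma clcomp_subproof (g h : 'L(X)) : (g \o h : X -> X) \in clmap_pred X X.
Proof.
apply/asboolP; split=> [a x y /=|x]; first by rewrite !linearP.
by apply: continuous_comp; exact: clmap_continuous.
Qed.

Definition clcomp (g h : 'L(X)) : 'L(X) := Clmap (clcomp_subproof g h).

Definition is_clgroup (G : set 'L(X)) : Prop :=
  [/\ G clid,
      forall g h, G g -> G h -> G (clcomp g h) &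
      forall g, G g -> exists h, [/\ G h, clcomp h g = clid & clcomp g h = clid]].

Definition isometric (G : set 'L(X)) : Prop :=
  forall g, G g -> forall x, `|g x| = `|x|.

Definition invariant_point (G : set 'L(X)) (x : X) : Prop :=
  forall g, G g -> g x = x.

Definition invariant_fun {T : Type} (G : set 'L(X)) (f : X -> T) : Prop :=
  forall g, G g -> forall x, f (g x) = f x.

Definition invariant_dual (G : set 'L(X)) : set (dual X) :=
  [set h | invariant_fun G h].

End group_of_maps.

Section convex_analysis.
Context {R : realType} {X : normedModType R}.
Implicit Type f : X -> \bar R.
Local Open Scope ereal_scope.

Definition dom f : set X := [set x | f x < +oo].

Definition proper_fun f : Prop :=
  (forall x, f x != -oo) /\ (exists x, f x != +oo).

(* Since [0 * +oo = 0] in [\bar R], the cases [t = 0] and [t = 1] hold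
   trivially, and no indeterminate sum occurs for [f] avoiding [-oo]. *)
Definition econvex f : Prop :=
  forall (x y : X) (t : R), (0 <= t <= 1)%R ->
    f (t *: x + (1 - t) *: y)%R <= t%:E * f x + (1 - t)%:E * f y.

(* These are meaningful for [x0] in [dom f]; both are empty when
   [f x0 = +oo], because [+oo - +oo = -oo] in [\bar R]. *)
Definition subdiff_eps f (eps : R) (x0 : X) : set (dual X) :=
  [set h | forall x, (h (x - x0)%R)%:E <= f x - f x0 + eps%:E].

Definition subdiff f (x0 : X) : set (dual X) :=
  [set h | forall x, (h (x - x0)%R)%:E <= f x - f x0].

End convex_analysis.

(* Main.v *)
(* Averaging: call a map in the convex hull of G a mean. A finite net of the
   norm-compact group G yields an averaging step which contracts the defect
   sup_(g, h) |g T h - T| of a mean T by a factor q < 1, so there are means T_n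
   with defect <= 1/(n + 1). If S and T have small defect then S T is close to
   both S and T; hence T_n x is Cauchy and converges to P x, where P is a linear
   nonexpansive projection onto the invariant points with P g = P for g in G
   and, by convexity and lower semicontinuity, f (P x) <= f x.

   Ekeland's variational principle for v := f - x0s on the invariant points of
   the domain of f provides z minimizing v + lam |. - z| there, and composing
   with P shows that z minimizes this function on the whole domain. By
   Hahn-Banach there is a linear h with |h| <= lam and h (y - z) <= v y - v z
   for all y; the functional x0s + h o P is then invariant and solves the
   problem. *)

Require Import Defs.
From HB Require Import structures.
From mathcomp Require Import all_boot all_order all_algebra.
From mathcomp Require Import all_classical all_reals all_analysis.
From mathcomp Require Import ring lra.

Import Order.TTheory GRing.Theory Num.Theory.
Import numFieldNormedType.Exports.

Local Open Scope classical_set_scope.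
Local Open Scope ring_scope.

(** * Nets, averages and limits in normed spaces *)

Lemma compact_net {R : realType} {V : normedModType R} (A : set V) (d : R) :
  compact A -> 0 < d ->
  exists s : seq V, (forall a, a \in s -> A a) /\
    forall x, A x -> exists2 a, a \in s & `|x - a| <= d.
Proof.
move=> + d0; rewrite compact_cover => /(_ V A (fun a => ball a d)).
case=> [a _|x Ax|D DA Acov].
- exact: ball_open.
- by exists x => //; exact: ballxx.
exists (finmap.enum_fset D); split=> [a /DA|x /Acov[a Da]]; first by rewrite inE.
by rewrite -ball_normE /= distrC => /ltW xa; exists a.
Qed.

(** Splitting off the entry [i0] lets one better bound [e] improve the average; this gain of one
    summand is the source of the contraction below. *)
Lemma mean_dist {R : realType} {V : normedModType R} {I : eqType} (l : seq I)
    (i0 : I) (F : I -> V) (y : V) (d e : R) :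
  i0 \in l -> (forall i, i \in l -> `|y - F i| <= d) -> `|y - F i0| <= e ->
  `|y - (size l)%:R^-1 *: \sum_(i <- l) F i| <=
    (size l)%:R^-1 * (e + (size l).-1%:R * d).
Proof.
move=> i0l lied i0e; have l0 : (size l)%:R != 0 :> R.
  by rewrite pnatr_eq0; case: l i0l {lied}.
have -> : y - (size l)%:R^-1 *: \sum_(i <- l) F i =
    (size l)%:R^-1 *: \sum_(i <- l) (y - F i).
  rewrite sumrB scalerBr; congr (_ - _).
  rewrite big_const_seq count_predT iter_addr_0 -(scaler_nat _ y) scalerA.
  by rewrite mulVf// scale1r.
rewrite normrZ ger0_norm ?invr_ge0// ler_wpM2l ?invr_ge0//.
apply: (le_trans (ler_norm_sum _ _ _)); rewrite (big_rem i0)//= lerD//.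
apply: (@le_trans _ _ (\sum_(i <- rem i0 l) d)).
  by rewrite [leLHS]big_seq [leRHS]big_seq ler_sum// => i /mem_rem; exact: lied.
by rewrite big_const_seq count_predT iter_addr_0 size_rem// mulr_natl.
Qed.

Lemma cvg_of_dist_le {R : realType} {X : completeNormedModType R}
    (u : nat -> X) (e : nat -> R) :
  e @ \oo --> (0 : R) -> (forall m n, (m <= n)%N -> `|u m - u n| <= e m) ->
  cvg (u @ \oo).
Proof.
move=> e0 ue; apply/cauchy_cvgP/cauchy_exP => r r0.
have /cvgrPdist_lt/(_ _ r0)[N _ eN] := e0.
exists (u N); exists N => //= n Nn /=; rewrite -ball_normE/=.
apply: (le_lt_trans (ue _ _ Nn)).
have := eN N (leqnn N); rewrite /= sub0r normrN; apply: le_lt_trans.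
exact: ler_norm.
Qed.

Lemma cvg_dist0 {R : realType} {V : normedModType R} (u v : nat -> V) {l : V}
    {e : nat -> R} : u @ \oo --> l -> e @ \oo --> (0 : R) ->
  (forall n, `|v n - u n| <= e n) -> v @ \oo --> l.
Proof.
move=> ul e0 uv.
have vu0 : v n - u n @[n --> \oo] --> (0 : V).
  apply/norm_cvg0P; apply: (@squeeze_cvgr _ _ _ _ (cst 0) e) => //.
    by near=> n; rewrite /= normr_ge0 uv.
  exact: cvg_cst.
rewrite (_ : v = fun n => u n + (v n - u n)); last first.
  by apply/funext => n; rewrite addrC subrK.
by rewrite -[l]addr0; apply: cvgD.
Unshelve. all: by end_near. Qed.

(** * Means over a group of isometries *)

(** Binary convex combinations of bare functions: any property stable under them passes from [G] to
    all means by induction. *)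
Inductive mean {R : realType} {X : normedModType R} (G : set 'L(X)) :
    (X -> X) -> Prop :=
| mean_base (g : 'L(X)) : G g -> mean G g
| mean_conv (t : R) (S T : X -> X) : 0 <= t <= 1 -> mean G S -> mean G T ->
    mean G (fun x => t *: S x + (1 - t) *: T x).

Section mean_theory.
Context {R : realType} {X : normedModType R} (G : set 'L(X)).
Implicit Types (S T : X -> X) (x : X).

Lemma norm_conv (V : normedModType R) (t : R) (x y : V) (d : R) :
  0 <= t <= 1 -> `|x| <= d -> `|y| <= d -> `|t *: x + (1 - t) *: y| <= d.
Proof.
move=> /andP[t0 t1] xd yd; rewrite (le_trans (ler_normD _ _))//.
rewrite !normrZ (ger0_norm t0) (@ger0_norm _ (1 - t)) ?subr_ge0//.
rewrite (_ : d = t * d + (1 - t) * d); last by ring.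
by rewrite lerD// ler_wpM2l// subr_ge0.
Qed.

Lemma convBr (V : lmodType R) (t : R) (x y z : V) :
  t *: x + (1 - t) *: y - z = t *: (x - z) + (1 - t) *: (y - z).
Proof.
rewrite !scalerBr addrACA -opprD -scalerDl.
by rewrite (_ : t + (1 - t) = 1) ?scale1r//; ring.
Qed.

Lemma mean_linear T : mean G T -> linear T.
Proof.
elim=> [g _|t S {}T _ _ lS _ lT] a x y; first by rewrite linearP.
by rewrite lS lT !scalerDr !scalerA (mulrC t) (mulrC (1 - t)) addrACA.
Qed.

Lemma mean_norm_le T x : isometric G -> mean G T -> `|T x| <= `|x|.
Proof.
by move=> isoG; elim=> [g /isoG ->|t S {}T t01 _ Sx _ Tx] //; exact: norm_conv.
Qed.

Lemma mean_fixed T x : invariant_point G x -> mean G T -> T x = x.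
Proof.
move=> Gx; elim=> [g /Gx //|t S {}T _ _ -> _ ->].
by rewrite -scalerDl (_ : t + (1 - t) = 1) ?scale1r//; ring.
Qed.

Lemma mean_translate g h T : is_clgroup G -> G g -> G h -> mean G T ->
  mean G (fun x => g (T (h x))).
Proof.
move=> [_ GM _] Gg Gh; elim=> [k Gk|t S {}T t01 _ mS _ mT].
  by apply: (mean_base _ (clcomp g (clcomp k h))); apply: (GM) => //; exact: (GM).
rewrite [X in mean _ X](_ : _ =
    fun x => t *: g (S (h x)) + (1 - t) *: g (T (h x))).
  exact: mean_conv.
by apply/funext => x; rewrite linearD !linearZ.
Qed.

Lemma mean_sum (I : eqType) (l : seq I) (F : I -> X -> X) : (0 < size l)%N ->
  (forall i, i \in l -> mean G (F i)) ->
  mean G (fun x => (size l)%:R^-1 *: \sum_(i <- l) F i x).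
Proof.
elim: l => // i [_ _ mF|j l IH _ mF].
  rewrite [X in mean _ X](_ : _ = F i); first by apply: mF; exact: mem_head.
  by apply/funext => x; rewrite big_seq1 invr1 scale1r.
have {}IH := IH isT (fun k kl => mF k (mem_behead (s := i :: _) kl)).
set n := size (j :: l) in IH.
have n0 : n%:R != 0 :> R by rewrite pnatr_eq0.
have n1 : n.+1%:R != 0 :> R by rewrite pnatr_eq0.
rewrite [X in mean _ X](_ : _ = fun x => n.+1%:R^-1 *: F i x +
    (1 - n.+1%:R^-1) *: (n%:R^-1 *: \sum_(i <- j :: l) F i x)).
  apply: mean_conv => //; last by apply: mF; exact: mem_head.
  by rewrite invr_ge0 ler0n/= invf_le1 ?ltr0n// ler1n.
apply/funext => x; rewrite big_cons scalerDr scalerA; congr (_ + _ *: _).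
rewrite -/n; move: n0 n1; rewrite -(natr1 n) => n0 n1.
by field; rewrite n0 n1.
Qed.

Lemma mean_dist_left S T (d : R) x : mean G S ->
  (forall g, G g -> `|g (T x) - T x| <= d) -> `|S (T x) - T x| <= d.
Proof.
move=> mS gT; elim: mS => [g /gT //|t S1 S2 t01 _ S1d _ S2d].
by rewrite convBr norm_conv.
Qed.

(** Here the convex combination sits inside [S], and linearity of [S] pulls it out before convexity
    of balls applies. *)
Lemma mean_dist_right S T (d : R) x : mean G S -> mean G T ->
  (forall g, G g -> `|S (g x) - S x| <= d) -> `|S (T x) - S x| <= d.
Proof.
move=> /mean_linear lS mT gS; elim: mT => [g /gS //|t T1 T2 t01 _ T1d _ T2d].
pose Sl : {linear X -> X} := HB.pack S (GRing.isLinear.Build _ _ _ _ S lS).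
by rewrite -[S]/(Sl : X -> X) linearD !linearZ/= convBr norm_conv.
Qed.

End mean_theory.

(** * Almost invariant means by contraction of the defect *)

Section invariant_mean.
Context {R : realType} {X : normedModType R} (G : set 'L(X)).
Implicit Types (S T : X -> X) (x : X).
Hypotheses (groupG : is_clgroup G) (isoG : isometric G).

(** The operator norm bound [|g T h - T| <= d], written pointwise because means are bare
    functions. *)
Definition almost_biinvariant (d : R) T : Prop :=
  forall g h x, G g -> G h -> `|g (T (h x)) - T x| <= d * `|x|.

(** Composing with the inverses of [g'] on the left and [h'] on the right, which preserves norms,
    turns the distance of two translates into a single defect. *)
Lemma almost_biinvariant_spread (d : R) T g h g' h' x :
  almost_biinvariant d T -> G g -> G h -> G g' -> G h' ->
  `|g (T (h x)) - g' (T (h' x))| <= d * `|x|.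
Proof.
case: groupG => _ GM GV dT Gg Gh Gg' Gh'.
have [a [Ga _ /(congr1 (fun k : 'L(X) => k _)) g'a]] := GV _ Gg'.
have [b [Gb /(congr1 (fun k : 'L(X) => k _)) bh' _]] := GV _ Gh'.
have := dT (clcomp a g) (clcomp h b) (h' x) (GM _ _ Ga Gg) (GM _ _ Gh Gb).
rewrite (isoG _ Gh') -(isoG _ Gg') linearB/=.
by move: (g'a (g (T (h (b (h' x)))))) (bh' x) => /= -> ->.
Qed.

(* Averaging over the size s ^ 2 maps a T b with a, b in the net: for any k, k' in
   G, one of them is within d / 2 of k T k' while the others are within d. *)
Lemma mean_contract (d : R) (s : seq 'L(X)) T : 0 < d ->
  (forall a, a \in s -> G a) ->
  (forall g, G g -> exists2 a, a \in s & `|g - a| <= d / 4) ->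
  mean G T -> almost_biinvariant d T ->
  exists2 S, mean G S &
    almost_biinvariant ((1 - (2 * (size s * size s)%:R)^-1) * d) S.
Proof.
move=> d0 sG netG mT dT.
pose l := [seq (a, b) | a <- s, b <- s].
pose F (i : 'L(X) * 'L(X)) x := i.1 (T (i.2 x)).
pose n := size l.
pose S x := n%:R^-1 *: \sum_(i <- l) F i x.
have lG i : i \in l -> G i.1 /\ G i.2.
  by case/allpairsP => -[a b] /= [/sG Ga /sG Gb ->].
have l0 : (0 < n)%N.
  case: groupG => /netG[a sa _] _ _.
  by rewrite /n size_allpairs muln_gt0 andbb; case: (s) sa.
have nE : n%:R = n.-1%:R + 1 :> R by rewrite natr1 prednK.
have n0 : n%:R != 0 :> R by rewrite pnatr_eq0 -lt0n.
have mS : mean G S.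
  apply: mean_sum => // i /lG[Gi1 Gi2]; exact: mean_translate.
exists S => // g h x Gg Gh.
have -> : (size s * size s)%N = n by rewrite /n size_allpairs.
set q := (X in X * d); pose r := q * d * `|x|.
have near_S k k' : G k -> G k' -> `|k (T (k' x)) - S x| <= r.
  move=> Gk Gk'.
  have [a sa ka] := netG _ Gk; have [b sb kb] := netG _ Gk'.
  have abl : (a, b) \in l by exact: allpairs_f.
  (* One term at [d / 2] and [n - 1] terms at [d] average to [(1 - 1 / (2 n)) d], hence the factor
     [q]. *)
  have -> : r = n%:R^-1 * (d / 2 * `|x| + n.-1%:R * (d * `|x|)).
    by rewrite /r /q; move: n0; rewrite nE => n0; field.
  apply: (mean_dist _ (a, b)) => // [i /lG[Gi1 Gi2]|].
    exact: almost_biinvariant_spread.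
  have net_le (u v : 'L(X)) y : `|u - v| <= d / 4 -> `|u y - v y| <= d / 4 * `|y|.
    by move=> uv; apply: (le_trans (le_opnorm (u - v) y)); rewrite ler_wpM2r.
  have Tx y z : T y - T z = T (y - z).
    by rewrite (additive_linear (mean_linear G T mT)).
  (* Replacing [k] by [a], then [k'] by [b], costs [d / 4] each time, since [T] is nonexpansive and
     [a], [k'] are isometries. *)
  rewrite /F/= (_ : _ - _ = (k (T (k' x)) - a (T (k' x))) +
      a (T (k' x - b x))); last by rewrite -Tx linearB addrA subrK.
  rewrite (_ : d / 2 * `|x| = d / 4 * `|x| + d / 4 * `|x|); last by field.
  rewrite (le_trans (ler_normD _ _))// lerD//.
    rewrite (le_trans (net_le _ _ _ ka))// ler_wpM2l//; first by lra.
    by rewrite (le_trans (mean_norm_le _ _ _ isoG mT))// (isoG _ Gk').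
  rewrite (isoG _ (sG _ sa)) (le_trans (mean_norm_le _ _ _ isoG mT))//.
  exact: net_le.
rewrite distrC.
(* [g S h] averages the maps [g a T b h], and [near_S] puts each of them within [r] of [S x]; so
   [mean_dist] is used with both bounds equal to [r]. *)
have -> : g (S (h x)) = n%:R^-1 *: \sum_(i <- l) g (F i (h x)).
  by rewrite linearZ linear_sum.
have -> : q * d * `|x| = n%:R^-1 * (r + n.-1%:R * r).
  by rewrite -/r; move: n0; rewrite nE => n0; field.
have [i0 i0l] : exists i0, i0 \in l.
  by move: l0; rewrite /n; case: (l) => // i0 l' _; exists i0; exact: mem_head.
have Fr i : i \in l -> `|S x - g (F i (h x))| <= r.
  case: groupG => _ GM _ /lG[Gi1 Gi2]; rewrite distrC.
  by apply: (near_S (clcomp g i.1) (clcomp i.2 h)); exact: GM.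
by apply: (mean_dist _ i0) => //; exact: Fr.
Qed.

Lemma almost_biinvariantW (d e : R) T :
  d <= e -> almost_biinvariant d T -> almost_biinvariant e T.
Proof.
by move=> de dT g h x Gg Gh; rewrite (le_trans (dT _ _ _ Gg Gh))// ler_wpM2r.
Qed.

Lemma almost_biinvariant_mean (d : R) : compact G -> 0 < d ->
  exists2 T, mean G T & almost_biinvariant d T.
Proof.
move=> compactG d0; have [G1 GM GV] := groupG.
have d40 : 0 < d / 4 by lra.
have [s [sG netG]] := compact_net G (d / 4) compactG d40.
pose N : R := (size s * size s)%:R.
have N1 : 1 <= N.
  have [a sa _] := netG _ G1.
  by rewrite ler1n muln_gt0 andbb; case: (s) sa.
pose q := 1 - (2 * N)^-1.
have V1 : 0 < (2 * N)^-1 <= 1.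
  by rewrite invr_gt0 invf_le1//; lra.
have q0 : 0 <= q by rewrite /q; lra.
have q1 : q < 1 by rewrite /q; lra.
(* Taking the maximum with [d] keeps the net of mesh [d / 4] fine enough at every iteration, so [s]
   and [q] never change. The constant 2 bounds the defect of the identity. *)
have qT m : exists2 T, mean G T & almost_biinvariant (Num.max d (2 * q ^+ m)) T.
  elim: m => [|m [T mT]].
    exists (clid : 'L(X)); first exact: mean_base.
    move=> g h x Gg Gh /=; rewrite expr0 mulr1.
    apply: (@le_trans _ _ (2 * `|x|)).
      rewrite (le_trans (ler_normB _ _))// (isoG _ Gg) (isoG _ Gh).
      by rewrite mulrDl mul1r.
    by rewrite ler_wpM2r// le_max lexx orbT.
  set e := Num.max _ _ => eT.
  have de : d <= e by rewrite le_max lexx.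
  have netG' g : G g -> exists2 a, a \in s & `|g - a| <= e / 4.
    by move=> /netG[a sa ga]; exists a => //; apply: (le_trans ga); lra.
  have [S mS qS] := mean_contract e s T (lt_le_trans d0 de) sG netG' mT eT.
  exists S => //; apply: almost_biinvariantW qS.
  rewrite -/N -/q /e (maxr_pMr _ _ q0) ge_max !le_max exprS (mulrCA 2) lexx orbT.
  by rewrite andbT ler_piMl// ltW.
have /cvgrPdist_lt/(_ (d / 2))[|m _ /(_ _ (leqnn m)) /=] :
  q ^+ n @[n --> \oo] --> 0 by apply: cvg_expr; rewrite ger0_norm.
  by lra.
rewrite sub0r normrN ger0_norm ?exprn_ge0// => qm.
have [T mT qmT] := qT m; exists T => //.
by apply: almost_biinvariantW qmT; rewrite ge_max lexx/=; lra.
Qed.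

End invariant_mean.

(** * The invariant projection as a limit of means *)

(** The approximating means are exported too, because the further properties of [P] are obtained as
    limits of properties of means. *)
Lemma invariant_mean_projection {R : realType} {X : completeNormedModType R}
    (G : set 'L(X)) : is_clgroup G -> compact G -> isometric G ->
  exists P : X -> X, exists2 T_ : nat -> X -> X,
    (forall n, mean G (T_ n)) /\ (forall x, T_ n x @[n --> \oo] --> P x) &
    forall g x, G g -> g (P x) = P x /\ P (g x) = P x.
Proof.
move=> groupG compactG isoG; have [G1 _ _] := groupG.
have ex_T (n : nat) : exists T, mean G T /\ almost_biinvariant G n.+1%:R^-1 T.
  have n0 : 0 < n.+1%:R^-1 :> R by rewrite invr_gt0.
  by have [T mT nT] := almost_biinvariant_mean G groupG isoG _ compactG n0; exists T.
have [T_ T_P] := choice ex_T.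
have mT n := (T_P n).1; have TG n := (T_P n).2.
have harm (x : X) : n.+1%:R^-1 * `|x| @[n --> \oo] --> (0 : R).
  rewrite -[X in _ --> X](mul0r `|x|); apply: cvgMr_tmp; exact: cvg_harmonic.
have cT x : cvg (T_ n x @[n --> \oo]).
  apply: (@cvg_of_dist_le _ _ _ (fun n => 2 * (n.+1%:R^-1 * `|x|))).
    by rewrite -[X in _ --> X](mulr0 2); apply: cvgMl_tmp; exact: harm.
  move=> m n mn.
  (* [T_ m (T_ n x)] is the intermediate point: near [T_ m x] by right almost invariance of [T_ m],
     near [T_ n x] by left almost invariance of [T_ n]. *)
  have Tmn : `|T_ m (T_ n x) - T_ m x| <= m.+1%:R^-1 * `|x|.
    apply: (mean_dist_right G _ _ _ _ (mT m) (mT n)) => g Gg; exact: (TG m clid g x).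
  have Tnm : `|T_ m (T_ n x) - T_ n x| <= m.+1%:R^-1 * `|x|.
    apply: (mean_dist_left G _ _ _ _ (mT m)) => g Gg.
    apply: (le_trans (TG n g clid x _ _)) => //.
    by rewrite ler_wpM2r// lef_pV2 ?posrE// ler_nat.
  rewrite -(subrKA (T_ m (T_ n x))) (le_trans (ler_normD _ _))// mulrDl mul1r.
  by rewrite lerD// distrC.
exists (fun x => lim (T_ n x @[n --> \oo])), T_ => //.
move=> g x Gg; split.
  apply: (@cvg_unique _ (@norm_hausdorff _ _) (g (T_ n x) @[n --> \oo])) => //=.
    exact: (cvg_comp _ _ (cT x) (@clmap_continuous _ _ _ g _)).
  apply: (cvg_dist0 (fun n => T_ n x) (fun n => g (T_ n x)) (cT x) (harm x)) => n.
  exact: (TG n g clid x).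
apply: (cvg_lim (@norm_hausdorff _ _)).
apply: (cvg_dist0 (fun n => T_ n x) (fun n => T_ n (g x)) (cT x) (harm x)) => n.
exact: (TG n clid g x).
Qed.

(** A real number strictly between [phi x] and [f x] keeps the two apart on a neighbourhood.
    Constant [phi] gives sublevel sets; a varying one is needed for the slices in the variational
    principle. *)
Lemma closed_le_lsc {R : realType} {X : normedModType R} (f : X -> \bar R)
    (phi : X -> R) : lower_semicontinuous f -> continuous phi ->
  closed [set x | (f x <= (phi x)%:E)%E].
Proof.
move=> lscf cphi; rewrite -openC openE => x /= /negP; rewrite -ltNge => phif.
have [a xa af] : exists2 a, phi x < a & (a%:E < f x)%E.
  move: phif; case: (f x) => [r|_|//].
    by rewrite lte_fin => ?; exists ((phi x + r) / 2); rewrite ?lte_fin; lra.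
  by exists (phi x + 1); [lra|rewrite ltry].
have [V Vx Vf] := lscf x a af.
have /cvgr_lt/(_ _ xa) phia := cphi x.
apply: filterS2 Vx phia => y Vy ya /=; apply/negP; rewrite -ltNge.
by rewrite (lt_trans _ (Vf _ Vy))// lte_fin.
Qed.

Lemma mean_le {R : realType} {X : normedModType R} (G : set 'L(X))
    (f : X -> \bar R) (T : X -> X) (x : X) : econvex f -> invariant_fun G f ->
  mean G T -> (f (T x) <= f x)%E.
Proof.
move=> convf Gf; elim=> [g /Gf ->//|t S {}T /[dup] t01 /andP[t0 t1] _ Sx _ Tx].
apply: (le_trans (convf _ _ _ t01)).
rewrite -[leRHS]mul1e (_ : 1%:E = t%:E + (1 - t)%:E)%E; last first.
  by rewrite -EFinD; congr EFin; ring.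
rewrite ge0_muleDl ?lee_fin ?subr_ge0// leeD// lee_wpmul2l// lee_fin subr_ge0//.
Qed.

Lemma mean_invariant_dual {R : realType} {X : normedModType R} (G : set 'L(X))
    (h : dual X) (T : X -> X) (x : X) :
  invariant_dual G h -> mean G T -> h (T x) = h x.
Proof.
move=> Gh; elim=> [g /Gh //|t S {}T _ _ hS _ hT].
by rewrite linearD !linearZ/= hS hT -scalerDl (_ : t + (1 - t) = 1) ?scale1r//; ring.
Qed.

Lemma closed_invariant {R : realType} {X : normedModType R} (G : set 'L(X)) :
  closed (invariant_point G).
Proof.
rewrite (_ : invariant_point G =
    \bigcap_(g in G) (fun x => g x - x) @^-1` [set 0]); last first.
  apply/seteqP; split=> x Gx g Gg; first by rewrite /= (Gx _ Gg) subrr.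
  by apply/eqP; rewrite -subr_eq0; apply/eqP; exact: Gx.
apply: closed_bigI => g _; apply: closed_comp => [x _|].
  by apply: cvgB; [exact: clmap_continuous|exact: cvg_id].
exact/accessible_closed_set1/hausdorff_accessible/norm_hausdorff.
Qed.

(** Apart from the invariance under [G], each clause holds for means and survives the pointwise
    limit; the bound on [f] uses real levels [r] because sublevel sets are closed. *)
Lemma invariant_projection {R : realType} {X : completeNormedModType R}
    (G : set 'L(X)) : is_clgroup G -> compact G -> isometric G ->
  exists P : X -> X,
    [/\ linear P, forall x, `|P x| <= `|x|, forall x, invariant_point G (P x),
        forall g x, G g -> P (g x) = P x &
        forall x, invariant_point G x -> P x = x] /\
    (forall (h : dual X) x, invariant_dual G h -> h (P x) = h x) /\
    (forall (f : X -> \bar R) x r, econvex f -> lower_semicontinuous f ->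
       invariant_fun G f ->
       (f x <= r%:E)%E -> (f (P x) <= r%:E)%E).
Proof.
move=> groupG compactG isoG.
have [P [T_ [mT TP] PG]] := invariant_mean_projection G groupG compactG isoG.
have limP x y : T_ n x @[n --> \oo] --> y -> P x = y.
  exact: (@cvg_unique _ (@norm_hausdorff _ _) _ _ _ _ (TP x)).
exists P; split; [split|split].
- move=> a x y; apply: limP.
  rewrite (_ : (fun n => _) = fun n => a *: T_ n x + T_ n y).
    by apply: cvgD; [apply: cvgZl_tmp; exact: TP|exact: TP].
  by apply/funext => n; rewrite (mean_linear G _ (mT n)).
- move=> x; apply: (@cvgr_to_le _ \oo _ _ (fun n => `|T_ n x|)).
    by apply: cvg_norm; exact: TP.
  by near=> n; apply: (mean_norm_le G).
- by move=> x g Gg; have [] := PG g x Gg.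
- by move=> g x Gg; have [] := PG g x Gg.
- move=> x Gx; apply: limP; rewrite (_ : (fun n => _) = cst x); first exact: cvg_cst.
  by apply/funext => n; exact: mean_fixed Gx (mT n).
- move=> h x Gh.
  apply: (@cvg_unique _ (@norm_hausdorff _ R^o) (h (T_ n x) @[n --> \oo])) => /=.
    exact: (cvg_comp _ _ (TP x) (@clmap_continuous _ _ _ h _)).
  rewrite (_ : (fun n => _) = cst (h x)); first exact: cvg_cst.
  by apply/funext => n; exact: mean_invariant_dual Gh (mT n).
- move=> f x r convf lscf Gf fxr.
  apply: (@closed_cvg _ _ _ _ (fun n => T_ n x) [set y | (f y <= r%:E)%E]) (TP x).
    by apply: (closed_le_lsc f (fun=> r)) => // y; exact: cvg_cst.
  by near=> n; apply: (le_trans _ fxr); exact: mean_le convf Gf (mT n).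
Unshelve. all: by end_near. Qed.

(** * The Hahn-Banach theorem *)

(** The inequality for [a > 0] suffices: applied to the inverse of [a] it yields equality. *)
Definition sublinear {R : realType} {V : lmodType R} (q : V -> R) : Prop :=
  (forall x y, q (x + y) <= q x + q y) /\
  (forall a x, 0 < a -> q (a *: x) <= a * q x).

Section sublinear_theory.
Context {R : realType} {V : lmodType R}.
Implicit Types p q : V -> R.

Lemma sublinear0 q : sublinear q -> q 0 = 0.
Proof.
case=> qD qZ.
have := qD 0 0; have := qZ 2^-1 0; rewrite addr0 scaler0 invr_gt0.
by move=> /(_ (ltr0Sn _ _)); lra.
Qed.

Lemma sublinearZ q a x : sublinear q -> 0 <= a -> q (a *: x) = a * q x.
Proof.
move=> sq; rewrite le_eqVlt => /predU1P[<-|a0].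
  by rewrite scale0r mul0r sublinear0.
case: sq => _ qZ; apply/eqP; rewrite eq_le qZ//=.
have V0 : 0 < a^-1 by rewrite invr_gt0.
by have := qZ _ (a *: x) V0; rewrite scalerK ?gt_eqF// ler_pdivlMl.
Qed.

Lemma sublinear_ge_opp q x : sublinear q -> - q (- x) <= q x.
Proof.
move=> sq; have := sq.1 x (- x); rewrite subrr sublinear0//.
by lra.
Qed.

(** Shared by three infima: over a chain of sublinear functions, in the proof of additivity, and in
    an infimal convolution. *)
Lemma sublinear_inf (I : V -> set R) (m : V -> R) :
  (forall x, I x !=set0) -> (forall x, lbound (I x) (m x)) ->
  (forall x y r s, I x r -> I y s -> exists2 u, I (x + y) u & u <= r + s) ->
  (forall a x r, 0 < a -> I x r -> exists2 u, I (a *: x) u & u <= a * r) ->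
  sublinear (fun x => inf (I x)).
Proof.
move=> I0 mI ID IZ.
have lI x : has_lbound (I x) by exists (m x); exact: mI.
split=> [x y|a x a0].
  rewrite -lerBlDr; apply: lb_le_inf => // r Ir.
  rewrite lerBlDl -lerBlDr; apply: lb_le_inf => // s Is.
  have [u Iu urs] := ID _ _ _ _ Ir Is.
  by rewrite lerBlDl (le_trans _ urs)//; exact: ge_inf.
rewrite -ler_pdivrMl//; apply: lb_le_inf => // r Ir.
have [u Iu uar] := IZ _ _ _ a0 Ir.
by rewrite ler_pdivrMl// (le_trans _ uar)//; exact: ge_inf.
Qed.

(** Zorn's lemma for the reversed pointwise order. A chain is bounded by its pointwise infimum,
    finite since [- p (- x) <= - q (- x) <= q x]. *)
Lemma minimal_sublinear p : sublinear p ->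
  exists q, [/\ sublinear q, forall x, q x <= p x &
    forall q', sublinear q' -> (forall x, q' x <= q x) -> q' = q].
Proof.
move=> sp.
pose T := {q | sublinear q /\ forall x, q x <= p x}.
pose below (q q' : T) : bool := `[< forall x, sval q' x <= sval q x >].
have svalE (q q' : T) : sval q = sval q' -> q = q'.
  case: q q' => [q sq] [q' sq'] /= qq'; subst q'.
  congr (exist _ _ _); exact: Prop_irrelevance.
have [|||A totA|] := @Zorn T below.
- by move=> q; apply/asboolP.
- move=> q r s /asboolP qr /asboolP rs; apply/asboolP => x.
  exact: le_trans (rs x) (qr x).
- move=> q r /asboolP qr /asboolP rq; apply: svalE; apply/funext => x.
  by apply/eqP; rewrite eq_le qr rq.
(* The empty chain is bounded by [p] itself. *)
- have [[q0 Aq0]|A0] := pselect (exists q : T, A q); last first.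
    exists (exist _ p (conj sp (fun x => lexx _))) => s As.
    by exfalso; apply: A0; exists s.
  pose I x := [set sval q x | q in A].
  have lbI x : lbound (I x) (- p (- x)).
    move=> _ [q Aq <-]; case: (svalP q) => sq qp.
    by rewrite (le_trans _ (sublinear_ge_opp _ _ sq))// lerN2.
  have I0 x : I x !=set0 by exists (sval q0 x), q0.
  have sI : sublinear (fun x => inf (I x)).
    apply: (sublinear_inf I (fun x => - p (- x))) => //.
      move=> x y _ _ [q Aq <-] [r Ar <-].
      have [s [As sq sr]] : exists s, [/\ A s, forall x, sval s x <= sval q x &
          forall x, sval s x <= sval r x].
        have [/asboolP rq|/asboolP qr] := totA _ _ Aq Ar; first by exists r.
        by exists q.
      exists (sval s (x + y)); first by exists s.
      by rewrite (le_trans ((svalP s).1.1 x y))// lerD.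
    move=> a x _ a0 [q Aq <-]; exists (sval q (a *: x)); first by exists q.
    exact: ((svalP q).1.2 a x a0).
  have Ip x : inf (I x) <= p x.
    apply: le_trans ((svalP q0).2 x); apply: ge_inf; last by exists q0.
    by exists (- p (- x)).
  exists (exist _ (fun x => inf (I x)) (conj sI Ip)) => s As; apply/asboolP => x /=.
  by apply: ge_inf; [exists (- p (- x))|exists s].
move=> q qmin; have [sq qp] := svalP q.
exists (sval q); split => // q' sq' q'q.
have q'p x : q' x <= p x by exact: le_trans (q'q x) (qp x).
have qq' : below q (exist _ q' (conj sq' q'p)) by apply/asboolP.
exact: (congr1 sval (qmin _ qq')).
Qed.

Lemma minimal_sublinear_additive q : sublinear q ->
    (forall q', sublinear q' -> (forall x, q' x <= q x) -> q' = q) ->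
  forall x y, q (x + y) = q x + q y.
Proof.
move=> sq qmin x y; apply/eqP; rewrite eq_le sq.1/=.
(* x |-> inf_t (q (x + t y) - t q y) is sublinear and below q, hence equals q by
   minimality; t = 1 gives superadditivity. *)
pose I x := [set q (x + t *: y) - t * q y | t in [set t | 0 <= t]].
have lbI z : lbound (I z) (- q (- z)).
  move=> _ [t /= t0 <-]; rewrite -(sublinearZ _ _ _ sq t0).
  have := sq.1 (z + t *: y) (- z); rewrite addrAC subrr add0r.
  by lra.
have Iq z : I z (q z) by exists 0 => //=; rewrite scale0r addr0 mul0r subr0.
have sI : sublinear (fun z => inf (I z)).
  apply: (sublinear_inf I (fun z => - q (- z))) => //.
  - by move=> z; exists (q z).
  - move=> z w _ _ [t /= t0 <-] [s /= s0 <-].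
    exists (q (z + w + (t + s) *: y) - (t + s) * q y).
      by exists (t + s) => //=; exact: addr_ge0.
    by rewrite scalerDl addrACA mulrDl opprD [leRHS]addrACA lerD2r sq.1.
  - move=> a z _ a0 [t /= t0 <-].
    exists (q (a *: z + (a * t) *: y) - (a * t) * q y).
      by exists (a * t) => //=; rewrite mulr_ge0// ltW.
    by rewrite mulrBr mulrA lerD2r -scalerA -scalerDr sq.2.
have Iinf z : has_lbound (I z) by exists (- q (- z)).
have /(congr1 (@^~ x)) <- : (fun z => inf (I z)) = q.
  by apply: qmin => // z; apply: ge_inf.
rewrite -lerBrDr; apply: ge_inf => //.
by exists 1 => //=; rewrite scale1r mul1r.
Qed.

(** A minimal sublinear function is additive, hence odd, which extends positive homogeneity to all
    scalars. *)
Lemma sublinear_above_linear p : sublinear p ->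
  exists2 h : V -> R, linear h & forall x, h x <= p x.
Proof.
move=> /minimal_sublinear[q [sq qp /(minimal_sublinear_additive _ sq) qD]].
exists q => // a x y; rewrite qD; congr (_ + _).
have qN z : q (- z) = - q z.
  by apply/eqP; rewrite -addr_eq0 -qD addrC subrr sublinear0.
have [a0|a0] := leP 0 a; first exact: sublinearZ.
rewrite -[in LHS](opprK a) scaleNr qN (sublinearZ _ _ _ sq) ?oppr_ge0 ?ltW//.
by rewrite mulNr opprK.
Qed.

End sublinear_theory.

(** [C] is a convex cone in the product of [V] with the reals. A linear map below its infimal
    convolution with [lam * |.|] satisfies both bounds: split [w] as [0 + w] or as [w + 0]. *)
Lemma cone_sandwich {R : realType} {V : normedModType R} (lam : R)
    (C : V -> set R) : 0 <= lam -> C 0 0 ->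
  (forall x y r s, C x r -> C y s -> C (x + y) (r + s)) ->
  (forall a x r, 0 < a -> C x r -> C (a *: x) (a * r)) ->
  (forall x r, C x r -> - (lam * `|x|) <= r) ->
  exists2 h : V -> R, linear h &
    (forall x, `|h x| <= lam * `|x|) /\ (forall x r, C x r -> h x <= r).
Proof.
move=> lam0 C0 CD CZ Cge.
pose I w := [set r | exists x s, C x s /\ r = s + lam * `|w - x|].
have lbI w : lbound (I w) (- (lam * `|w|)).
  move=> _ [x [s [/Cge + ->]]].
  have : lam * `|x| <= lam * `|w| + lam * `|w - x|.
    by rewrite -mulrDr ler_wpM2l// -{1}(subKr w x) ler_normB.
  by lra.
have Iinf w : has_lbound (I w) by exists (- (lam * `|w|)).
have [|h lh hp] := sublinear_above_linear (fun w => inf (I w)).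
  apply: (sublinear_inf I (fun w => - (lam * `|w|))) => //.
  - by move=> w; exists (0 + lam * `|w - 0|), 0, 0.
  - move=> w w' _ _ [x [s [Cx ->]]] [x' [s' [Cx' ->]]].
    exists (s + s' + lam * `|w + w' - (x + x')|).
      by exists (x + x'), (s + s'); split => //; exact: CD.
    rewrite addrACA lerD2l -mulrDr ler_wpM2l// opprD addrACA.
    exact: ler_normD.
  - move=> a w _ a0 [x [s [Cx ->]]].
    exists (a * s + lam * `|a *: w - a *: x|).
      by exists (a *: x), (a * s); split => //; exact: CZ.
    by rewrite -scalerBr normrZ gtr0_norm// mulrDr mulrCA.
have hlam x : h x <= lam * `|x|.
  apply: (le_trans (hp x)); apply: ge_inf => //.
  by exists 0, 0; rewrite subr0 add0r.
pose hl : {linear V -> R} := HB.pack h (GRing.isLinear.Build _ _ _ _ h lh).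
exists h => //; split=> [x|x r Cx].
  rewrite ler_norml hlam andbT lerNl -[h]/(hl : V -> R) -linearN/= -normrN.
  exact: hlam.
apply: (le_trans (hp x)); apply: ge_inf => //.
by exists x, r; rewrite subrr normr0 mulr0 addr0.
Qed.

(** * The variational principle *)

(** Closed slices replace semicontinuity of [v], which will be meaningful on [D] only.
    Near-minimisers chosen in nested slices force the radii to 0. *)
Lemma ekeland {R : realType} {X : completeNormedModType R} (D : set X)
    (v : X -> R) (lam m : R) (x0 : X) :
  0 < lam -> (forall x, D x -> m <= v x) ->
  (forall x, D x -> closed [set y | D y /\ v y + lam * `|y - x| <= v x]) ->
  D x0 ->
  exists z, [/\ D z, v z + lam * `|z - x0| <= v x0 &
    forall y, D y -> v z <= v y + lam * `|y - z|].
Proof.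
move=> lam0 mv Sclosed Dx0.
pose S x := [set y | D y /\ v y + lam * `|y - x| <= v x].
have S_refl x : D x -> S x x by move=> Dx; split; rewrite // subrr normr0 mulr0 addr0.
have S_trans x y z : S x y -> S y z -> S x z.
  move=> [_ yx] [Dz zy]; split => //.
  have : lam * `|z - x| <= lam * `|z - y| + lam * `|y - x|.
    by rewrite -mulrDr ler_wpM2l ?(ltW lam0)// ler_distD.
  by lra.
(* The pair carries the step number, which sets the tolerance; guarding by [D] makes the choice
   function total. *)
have next (nx : nat * X) : exists y, D nx.2 -> S nx.2 y /\
    forall w, S nx.2 w -> v y <= v w + lam * nx.1.+1%:R^-1.
  case: nx => n x /=; have [Dx|] := pselect (D x); last by exists x.
  have e0 : 0 < lam * n.+1%:R^-1 by rewrite mulr_gt0 ?invr_gt0.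
  have hasS : has_inf [set v y | y in S x].
    split; first by exists (v x), x => //; exact: S_refl.
    by exists m => _ [y [Dy _] <-]; exact: mv.
  have [_ [y Sy <-] vy] := inf_adherent e0 hasS.
  exists y => _; split => // w Sw; rewrite (le_trans (ltW vy))// lerD2r.
  by apply: ge_inf; [case: hasS|exists w].
have [F FP] := choice next.
pose u := nat_rect (fun=> X) x0 (fun n x => F (n, x)).
have Du n : D (u n).
  by elim: n => //= n Dn; have [[]] := FP (n, u n) Dn.
have uS n : S (u n) (u n.+1) by have [] := FP (n, u n) (Du n).
have Su m1 n : (m1 <= n)%N -> S (u m1) (u n).
  move=> /subnK <-; elim: (n - m1)%N => [|k IH]; first exact: S_refl.
  by rewrite addSn; apply: S_trans IH (uS _).
(* Near-minimality gives [v (u n.+1) <= v y + lam / (n + 1)], while membership in the slice gives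
   [v y + lam * |y - u n.+1| <= v (u n.+1)]. *)
have u_close n y : S (u n.+1) y -> `|y - u n.+1| <= n.+1%:R^-1.
  move=> Sy; have Sny := S_trans _ _ _ (uS n) Sy.
  have [_ vu] := FP (n, u n) (Du n).
  have {}vu : v (u n.+1) <= v y + lam * n.+1%:R^-1 := vu y Sny.
  rewrite -(ler_pM2l lam0); move: vu (Sy.2).
  by move: (u n.+1) (n.+1%:R^-1) => w r; lra.
have cu : cvg ((fun n => u n.+1) @ \oo).
  apply: (cvg_of_dist_le _ harmonic); first exact: cvg_harmonic.
  by move=> k n kn; rewrite distrC; apply: u_close; exact: Su.
set z := lim ((fun n => u n.+1) @ \oo) in cu.
have Sz n : S (u n) z.
  apply: (@closed_cvg _ _ _ _ (fun k => u k.+1) _ (Sclosed _ (Du n)) _ _ cu).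
  by exists n => // k nk; exact: (Su n k.+1 (leqW nk)).
exists z; have [Dz zx0] := Sz 0%N; split => // y Dy.
(* A violating [y] would lie in the slice of [z], hence in all slices, so the sequence would also
   converge to [y]. *)
rewrite leNgt; apply/negP => yz.
have Szy : S z y by split => //; exact: ltW.
have uy n : `|y - u n.+1| <= n.+1%:R^-1.
  exact/u_close/(S_trans _ _ _ (Sz _) Szy).
have uyl : (fun n => u n.+1) @ \oo --> y.
  apply: (cvg_dist0 (fun=> y) _ (cvg_cst y) cvg_harmonic) => n.
  by rewrite distrC; exact: uy.
have zy : z = y by apply: (cvg_lim (@norm_hausdorff _ _)).
by move: yz; rewrite zy subrr normr0 mulr0 addr0 ltxx.
Qed.

(** * Exact invariant subgradients near an approximate one *)

Theorem theorem29 (R : realType) (X : completeNormedModType R)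
  (G : set 'L(X)) (f : X -> \bar R) :
  is_clgroup G -> compact G -> isometric G ->
  proper_fun f -> econvex f -> lower_semicontinuous f -> invariant_fun G f ->
  forall (eps lam : R), 0 < eps -> 0 < lam ->
  forall (x0 : X), dom f x0 -> invariant_point G x0 ->
  forall (x0s : dual X), invariant_dual G x0s -> subdiff_eps f eps x0 x0s ->
  exists (z : X) (xs : dual X),
    [/\ dom f z /\ invariant_point G z,
        invariant_dual G xs,
        subdiff f z xs,
        `|z - x0| <= eps / lam &
        `|xs - x0s| <= lam].
Proof.
move=> groupG compactG isoG [fNy _] convf lscf Gf eps lam eps0 lam0 x0 fx0 Gx0.
move=> x0s Gx0s sub_x0.
have [P [[lP normP GP PG Pfix] [dualP fP]]] :=
  invariant_projection G groupG compactG isoG.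
(* [fine] sends [+oo] to 0, so estimates on [v] are restricted to [dom f]. *)
pose v x : R := fine (f x) - x0s x.
have fE x : dom f x -> f x = (fine (f x))%:E.
  by rewrite /dom/= => fx; rewrite fineK// fin_numE fNy lt_eqF.
have domE x r : (f x <= r%:E)%E -> dom f x.
  by move=> fr; apply: (le_lt_trans fr); rewrite ltry.
have v_conv t x y : 0 <= t <= 1 -> dom f x -> dom f y ->
    dom f (t *: x + (1 - t) *: y) /\
    v (t *: x + (1 - t) *: y) <= t * v x + (1 - t) * v y.
  move=> t01 fx fy; have := convf x y t t01.
  rewrite (fE x fx) (fE y fy) -!EFinM -EFinD => fr.
  have fxy := domE _ _ fr; split=> //; move: fr; rewrite (fE _ fxy) lee_fin.
  rewrite /v linearD !linearZ/=.
  rewrite /GRing.scale/=; lra.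
(* The subdifferential hypothesis says that [x0] minimises [v] up to [eps]. *)
have v_ge x : dom f x -> v x0 - eps <= v x.
  move=> fx; have := sub_x0 x.
  rewrite (fE x fx) (fE x0 fx0) -EFinB -EFinD lee_fin linearB/= /v.
  by lra.
pose D := [set x | invariant_point G x /\ dom f x].
have Sclosed x : D x -> closed [set y | D y /\ v y + lam * `|y - x| <= v x].
  (* Solving the slice inequality for [f y] leaves a continuous right-hand side. *)
  move=> _; pose phi y := v x - lam * `|y - x| + x0s y.
  rewrite (_ : [set y | _] =
      invariant_point G `&` [set y | (f y <= (phi y)%:E)%E]); last first.
    apply/seteqP; split=> y /=.
      move=> [[Gy fy] vy]; split => //; rewrite (fE y fy) lee_fin.
      by move: vy; rewrite /phi /v; lra.
    move=> [Gy fy]; have fy' := domE _ _ fy; split => //.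
    by move: fy; rewrite (fE y fy') lee_fin /phi /v; lra.
  apply: closedI; first exact: closed_invariant.
  apply: closed_le_lsc => // y; apply: cvgD; last exact: clmap_continuous.
  apply: cvgB; first exact: cvg_cst.
  apply: cvgMl_tmp; apply: cvg_norm; apply: cvgB; first exact: cvg_id.
  exact: cvg_cst.
have [z [[Gz fz] zx0 zmin]] :=
  ekeland D v lam (v x0 - eps) x0 lam0 (fun x Dx => v_ge x Dx.2) Sclosed (conj Gx0 fx0).
pose PL : {linear X -> X} := HB.pack P (GRing.isLinear.Build _ _ _ _ P lP).
have PB x y : P (x - y) = P x - P y by exact: (linearB PL).
have vP x : dom f x -> dom f (P x) /\ v (P x) <= v x.
  move=> fx; have := fP f x (fine (f x)) convf lscf Gf.
  rewrite -(fE x fx) => /(_ (lexx _)) fPx.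
  have fPx' : dom f (P x) by exact: le_lt_trans fPx fx.
  by split=> //; rewrite /v dualP// lerD2r -lee_fin -!fE.
have vmin y : dom f y -> v z <= v y + lam * `|y - z|.
  move=> /vP[fPy vPy]; apply: (le_trans (zmin _ (conj (GP y) fPy))).
  by rewrite lerD// ler_wpM2l ?(ltW lam0)// -[X in P y - X](Pfix _ Gz) -PB.
(* The cone generated by the epigraph of [v] with its origin moved to [(z, v z)]; [vmin] keeps it
   above [- lam * |w|]. *)
pose C w := [set r | exists s y, [/\ 0 <= s, dom f y, w = s *: (y - z) &
  s * (v y - v z) <= r]].
have [||||h lh [hlam hC]] := cone_sandwich lam C (ltW lam0).
- by exists 0, z; split; rewrite ?scale0r ?mul0r.
- move=> _ _ r r' [s [y [s0 fy -> sr]]] [s' [y' [s'0 fy' -> sr']]].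
  have [ss0|ss0] := eqVneq (s + s') 0.
    have [es es'] : s = 0 /\ s' = 0 by lra.
    move: sr sr'; rewrite es es' !mul0r => r0 r'0.
    by exists 0, z; split; rewrite ?scale0r ?addr0 ?mul0r// addr_ge0.
  have ss : 0 < s + s' by rewrite lt_def ss0 addr_ge0.
  (* With this weight [s (y - z) + s' (y' - z)] is [s + s'] times the displacement from [z] of a
     convex combination, so convexity of [v] applies. *)
  pose t := s / (s + s').
  have t01 : 0 <= t <= 1.
    by rewrite divr_ge0 ?(ltW ss)//= ler_pdivrMr// mul1r lerDl.
  have ts : (s + s') * t = s by rewrite mulrC divfK.
  have ts' : (s + s') * (1 - t) = s' by rewrite mulrBr ts; ring.
  have [fyy vyy] := v_conv t y y' t01 fy fy'.
  exists (s + s'), (t *: y + (1 - t) *: y'); split => //; first exact: ltW.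
    by rewrite convBr [RHS]scalerDr !scalerA ts ts'.
  apply: (@le_trans _ _ ((s + s') * (t * v y + (1 - t) * v y' - v z))).
    by rewrite ler_wpM2l ?(ltW ss)// lerD2r.
  rewrite (_ : _ * _ = (s + s') * t * v y + (s + s') * (1 - t) * v y' -
    (s + s') * v z); last by ring.
  by rewrite ts ts'; move: sr sr'; lra.
- move=> a _ r a0 [s [y [s0 fy -> sr]]]; exists (a * s), y; split => //.
  + by rewrite mulr_ge0// ltW.
  + by rewrite scalerA.
  + by rewrite -mulrA ler_wpM2l// ltW.
- move=> _ r [s [y [s0 fy -> sr]]]; apply: le_trans sr.
  rewrite normrZ ger0_norm// mulrCA -mulrN ler_wpM2l//.
  by have := vmin y fy; lra.
have lhP : linear (h \o P) by move=> a x y; rewrite /= lP lh.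
pose hPL : {linear X -> R^o} :=
  HB.pack (h \o P) (GRing.isLinear.Build _ _ _ _ (h \o P : X -> R^o) lhP).
have hPle x : `|h (P x)| <= lam * `|x|.
  by rewrite (le_trans (hlam _))// ler_wpM2l ?(ltW lam0).
have hPP : (h \o P : X -> R^o) \in clmap_pred X R^o.
  apply/asboolP; split=> //; apply/(linear_bounded_continuous hPL)/bounded_funP => r.
  by exists (lam * r) => x xr; rewrite (le_trans (hPle x))// ler_wpM2l// ltW.
pose hP : dual X := Clmap hPP.
exists z, (x0s + hP); split => //.
- by move=> g Gg x; rewrite !clmapD (Gx0s _ Gg)/= PG.
- move=> x; have [fx|] := boolP (f x < +oo)%E; last first.
    rewrite -leNgt leye_eq => /eqP ->; rewrite (fE z fz).
    by rewrite addye// leey.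
  rewrite (fE x fx) (fE z fz) -EFinB lee_fin clmapD/= linearB/=.
  have [fPx vPx] := vP x fx.
  (* Scale 1 in the cone; [v (P x) <= v x] then returns from [P x] to [x]. *)
  have : h (P x - z) <= v (P x) - v z.
    by apply: hC; exists 1, (P x); split; rewrite ?scale1r ?mul1r.
  by rewrite PB (Pfix z Gz); move: vPx; rewrite /v; lra.
(* [lam * |z - x0| <= v x0 - v z <= eps]. *)
- by rewrite ler_pdivlMr// mulrC; have := v_ge z fz; lra.
- rewrite addrAC subrr add0r; apply: opnorm_le => x x1 /=.
  by rewrite (le_trans (hPle x))// ler_piMr// ltW.
Qed.
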